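(* Let $M=\mathbb{R}/\mathbb{Z}$ with Lebesgue measure $m$, let $f_0:M\to M$ be a $C^2$ local diffeomorphism with a unique saddle-node fixed point $0$ ($f_0(0)=0$, $f_0'(0)=1$, $f_0''(0)>0$), let $B(\{0\})=\{x\in M: f_0^k(x)\to0 \text{ as } k\to\infty\}$, let $W_0$ be the connected component of $B(\{0\})$ containing $0$, and assume $|f_0'(x)|>1$ for all $x\in M\setminus W_0$. Then $m(M\setminus B(\{0\}))=0$. *)

(* Defs.v *)
(* The circle M = R/Z is handled through lifts:
   a map f0 : M -> M is represented by a lift F : R -> R with
   F (x + 1) = F x + d for an integer d (the degree). *)
From HB Require Import structures.
From mathcomp Require Import all_boot all_order all_algebra.
From mathcomp Require Import all_classical all_reals all_analysis.
Set Implicit Arguments. Unset Strict Implicit. Unset Printing Implicit Defensive.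
Import Order.TTheory GRing.Theory Num.Theory.
Import numFieldNormedType.Exports.
Local Open Scope classical_set_scope.
Local Open Scope ring_scope.

(* x is an integer, i.e. x projects to 0 in R/Z *)
Definition is_int {R : realType} (x : R) : Prop := exists n : int, x = n%:~R.

Definition circ_dist0 {R : realType} (x : R) : R :=
  Num.min (x - (Num.floor x)%:~R) ((Num.ceil x)%:~R - x).

Definition circle_lift {R : realType} (F : R -> R) : Prop :=
  exists d : int, forall x, F (x + 1) = F x + d%:~R.

Definition C2 {R : realType} (F : R -> R) : Prop :=
  (forall x, derivable F x 1) /\ (forall x, derivable (derive1 F) x 1) /\
  continuous (derive1n 2 F).

Definition basin0 {R : realType} (F : R -> R) : set R :=
  [set x | (fun k : nat => circ_dist0 (iter k F x)) @ \oo --> (0 : R)].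

(* lift of W_0, the connected component of B({0}) in M containing 0:
   the class of x lies in W_0 iff some lift y of it is joined to 0 by a
   segment lying in (the lift of) B({0}). *)
Definition W0 {R : realType} (F : R -> R) : set R :=
  [set x | exists n : int,
     let y := x + n%:~R in
     forall z, Num.min 0 y <= z <= Num.max 0 y -> basin0 F z].

(* Main.v *)
(** Normalise the lift to [G] with [G 0 = 0]. Either every point of [(-1, 0)]
    moves to the right under [G], and the basin is everything, or there is a
    last fixed point [p = q - 1] in [(-1, 0)]; then [W0] is [(p, 0]] modulo the
    integers and [G' > 1] on [(0, q]]. The gaps [(m + q, m + 1)] lie in the
    basin, so a point outside the basin is a survivor: its orbit avoids all
    gaps. The set of survivors is porous at each of its points, hence null by
    the Lebesgue density theorem.

    A survivor that lands on an integer has a gap immediately to its left.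
    Otherwise, let [xs] be the backward orbit of [q] towards the neutral point
    [0]; it cuts [(0, q]] into fundamental domains [[xs (j+1), xs j]]. Passing
    from such a domain to [[xs 1, q]] and taking one more step is uniformly
    expanding, and its logarithmic derivative is uniformly Lipschitz in terms of
    the image point: the successive images of a fundamental domain are disjoint,
    which replaces the missing uniform expansion near [0]. Composing these
    passages yields arbitrarily small intervals around the survivor that an
    iterate maps onto a translate of [[0, q]] with bounded distortion, so that
    one step later a fixed proportion of each falls into a gap. *)
Require Import Defs.
From mathcomp Require Import all_boot all_order all_algebra.
From mathcomp Require Import all_classical all_reals all_analysis.
From mathcomp Require Import measurable_realfun ring lra.
Set Implicit Arguments. Unset Strict Implicit. Unset Printing Implicit Defensive.
Import Order.TTheory GRing.Theory Num.Theory.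
Import numFieldNormedType.Exports.
Local Open Scope classical_set_scope.
Local Open Scope ring_scope.

Section RealFunctions.
Variable R : realType.
Implicit Types (f df : R -> R) (A : set R).

Lemma is_derive_continuous f df :
  (forall x : R, is_derive x 1 f (df x)) -> continuous f.
Proof.
by move=> fdf x; apply/differentiable_continuous/derivable1_diffP/ex_derive.
Qed.

Lemma derivable_is_derive1 f : (forall x, derivable f x 1) ->
  forall x : R, is_derive x 1 f (derive1 f x).
Proof. by move=> df x; rewrite derive1E; exact/derivableP. Qed.

Lemma MVT_barycentric f df x y : (forall z : R, is_derive z 1 f (df z)) ->
  exists2 t, 0 < t < 1 & f y - f x = df (x + t * (y - x)) * (y - x).
Proof.
move=> fdf; have cf := continuous_subspaceT (is_derive_continuous fdf).
have [<-|xy] := eqVneq x y; first by exists 2^-1; rewrite ?subrr ?mulr0//; lra.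
have yx : y - x != 0 by rewrite subr_eq0 eq_sym.
suff [c c_xy e] : exists2 c, 0 < (c - x) / (y - x) < 1 &
    f y - f x = df c * (y - x).
  by exists ((c - x) / (y - x)); rewrite // divfK// subrKC.
move: xy; rewrite neq_lt => /orP[xy|xy].
  have [c] := MVT xy (fun z _ => fdf z) (cf _).
  rewrite in_itv/= => /andP[xc cy] e.
  exists c => //; have yx0 : 0 < y - x by rewrite subr_gt0.
  by rewrite divr_gt0 ?subr_gt0//= ltr_pdivrMr// mul1r ltrD2r.
have [c] := MVT xy (fun z _ => fdf z) (cf _).
rewrite in_itv/= => /andP[yc cx] e.
exists c; last by rewrite -opprB e -mulrN opprB.
have yx0 : 0 < x - y by rewrite subr_gt0.
rewrite -[c - x]opprB -[y - x]opprB invrN mulrNN.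
by rewrite divr_gt0 ?subr_gt0//= ltr_pdivrMr// mul1r ltrD2l ltrN2.
Qed.

Lemma MVT_norm f df a b : (forall z : R, is_derive z 1 f (df z)) ->
  {in `[a, b] &, forall x y,
    exists2 c, c \in `[a, b] & `|f x - f y| = `|df c| * `|x - y|}.
Proof.
move=> fdf x y; rewrite !in_itv/= => /andP[ax xb] /andP[ay yb].
have [t /andP[/ltW t0 /ltW t1] e] := MVT_barycentric y x fdf.
exists (y + t * (x - y)); last by rewrite e normrM.
rewrite -subr_ge0 in t1; rewrite in_itv/=.
have := mulr_ge0 t0 (_ : 0 <= x - a); have := mulr_ge0 t0 (_ : 0 <= b - x).
have := mulr_ge0 t1 (_ : 0 <= y - a); have := mulr_ge0 t1 (_ : 0 <= b - y).
rewrite !subr_ge0 => /(_ yb) + /(_ ay) + /(_ xb) + /(_ ax); lra.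
Qed.

Lemma neq0_continuous_gt0 f a :
  continuous f -> (forall x, f x != 0) -> 0 < f a -> forall x, 0 < f x.
Proof.
move=> cf f_neq0 fa x; rewrite ltNge; apply/negP => fx.
suff [c fc] : exists c, f c = 0 by have := f_neq0 c; rewrite fc eqxx.
have IVT0 u v : u <= v -> Num.min (f u) (f v) <= 0 <= Num.max (f u) (f v) ->
    exists c, f c = 0.
  by move=> uv /(IVT uv (continuous_subspaceT cf))[c]; exists c.
have fxa := le_trans fx (ltW fa).
have [xa|/ltW ax] := leP x a.
  by apply: (IVT0 _ _ xa); rewrite min_l// max_r// fx ltW.
by apply: (IVT0 _ _ ax); rewrite min_r// max_l// fx ltW.
Qed.

Lemma continuous_cvg_fixed f (u : nat -> R) l : continuous f ->
  u @ \oo --> l -> f (u k) @[k --> \oo] --> l -> f l = l.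
Proof.
move=> cf ul fl; apply: (cvg_unique _ _ fl); first exact: Rhausdorff.
exact: continuous_cvg (cf l) ul.
Qed.

Lemma periodic_int f : periodic f 1 -> forall (m : int) x, f (x + m%:~R) = f x.
Proof.
move=> f1 [n|n] x; first exact: (periodicn f1).
by rewrite NegzE mulrNz -[in RHS](subrK n.+1%:~R x) (periodicn f1).
Qed.

(* [A] and [B] need not be measurable: [lebesgue_measure] is an outer measure
   on all sets. *)
Lemma subset_lebesgue_measure0 A B : A `<=` B ->
  lebesgue_measure B = 0%E -> lebesgue_measure A = 0%E.
Proof.
move=> AB B0; apply/eqP; rewrite eq_le measure_ge0 andbT -B0.
exact: le_mu_ext.
Qed.

Definition porous_at A x := exists2 c, 0 < c & forall e, 0 < e ->
  exists r s t, [/\ 0 < r < e, x - r <= s, t <= x + r, c * r <= t - s &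
    `]s, t[ `<=` ~` A].

(* A point of porosity is never a Lebesgue density point. *)
Lemma porous_measure0 A : measurable A -> (forall x, A x -> porous_at A x) ->
  lebesgue_measure A = 0%E.
Proof.
move=> mA porA; apply: measure_negligible => //.
apply: negligibleS (lebesgue_density mA) => x Ax /= density.
have [c c0 {porA}porA] := porA x Ax; rewrite indicE mem_set//= in density.
have [e /= e0 dense] : \forall r \near (0 : R)^'+, ((1 - c / 2)%:E <
    lebesgue_measure (A `&` ball x r) * (lebesgue_measure (ball x r))^-1)%E.
  have lt1 : ((1 - c / 2)%:E < 1%:E)%E by rewrite lte_fin gtrBl divr_gt0.
  exact: (density _ (open_ereal_gt' lt1)).
have [r [s [t [/andP[r0 re] xrs txr crst gapA]]]] := porA e e0.
have st : s < t by rewrite -subr_gt0 (lt_le_trans _ crst)// mulr_gt0.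
have /dense /(_ r0) : ball (0 : R) e r.
  by rewrite -ball_normE/= sub0r normrN gtr0_norm.
have mAr : measurable (A `&` ball x r).
  by apply: measurableI => //; exact: measurable_ball.
have : (lebesgue_measure (A `&` ball x r) + (t - s)%:E <= (r *+ 2)%:E)%E.
  rewrite -(lebesgue_measure_ball x (ltW r0)).
  have -> : (t - s)%:E = lebesgue_measure `]s, t[.
    by rewrite lebesgue_measure_itv/= lte_fin st.
  rewrite -measureU//; last first.
    by apply/seteqP; split => // y [[Ay _] /gapA].
  apply: le_measure; rewrite ?inE//.
  - exact: measurableU.
  - exact: measurable_ball.
  move=> y [[]//|]; rewrite -ball_normE/= in_itv/= ltr_distlC => /andP[sy yt].
  by rewrite (le_lt_trans xrs sy) (lt_le_trans yt txr).
rewrite -leeBrDr// -EFinB => density_le.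
rewrite lebesgue_measure_ball ?(ltW r0)// inver mulrn_eq0/= gt_eqF//.
rewrite lte_pdivlMr ?pmulrn_lgt0// ltNge => /negP; apply.
apply: le_trans density_le _; rewrite -EFinM lee_fin.
by move: crst; rewrite mulr2n; lra.
Qed.

End RealFunctions.

Section CircleDistance.
Variable R : realType.
Implicit Types (x : R) (m : int).

Lemma circ_dist0_int x m : circ_dist0 (x + m%:~R) = circ_dist0 x.
Proof.
rewrite /circ_dist0; have -> : Num.floor (x + m%:~R) = Num.floor x + m.
  by apply: floor_def; have := floor_itv x; rewrite !intrD; lra.
have -> : Num.ceil (x + m%:~R) = Num.ceil x + m.
  by apply: ceil_def; have := ceil_itv x; rewrite !intrD; lra.
by rewrite !intrD; congr Num.min; ring.
Qed.

Lemma circ_dist0_ge0 x : 0 <= circ_dist0 x.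
Proof. by rewrite /circ_dist0 le_min !subr_ge0 floor_le ceil_ge. Qed.

Lemma circ_dist0_le_norm x : circ_dist0 x <= `|x|.
Proof.
rewrite /circ_dist0 ge_min; have [x0|/ltW x0] := leP 0 x.
  by rewrite ger0_norm// gerBl ler0z floor_ge0 x0.
by rewrite ler0_norm//; apply/orP; right; rewrite gerDr lerz0 ceil_le0.
Qed.

Lemma circ_dist0_01 x : 0 < x < 1 -> circ_dist0 x = Num.min x (1 - x).
Proof.
move=> /andP[x0 x1]; rewrite /circ_dist0.
have -> : Num.floor x = 0 by apply: floor_def; rewrite add0r (ltW x0) x1.
have -> : Num.ceil x = 1 by apply: ceil_def; rewrite subrr x0 (ltW x1).
by rewrite subr0.
Qed.

Lemma circ_dist0_cvg0 (u : nat -> R) :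
  u @ \oo --> 0 -> circ_dist0 (u k) @[k --> \oo] --> 0.
Proof.
move=> u0; apply: (@squeeze_cvgr _ _ _ _ (cst 0) (fun k => `|u k|)).
- by apply: nearW => k; rewrite circ_dist0_ge0 circ_dist0_le_norm.
- exact: cvg_cst.
- by rewrite -(normr0 R); exact: cvg_norm.
Qed.

Lemma cvg0_circ_dist0 (u : nat -> R) q : q < 1 -> (forall k, 0 < u k <= q) ->
  circ_dist0 (u k) @[k --> \oo] --> 0 -> u @ \oo --> 0.
Proof.
move=> q1 uq dist0; apply: (cvg_trans _ dist0); apply: near_eq_cvg.
have : 0 < 1 - q by rewrite subr_gt0.
move=> /(cvgr_lt 0 dist0); apply: filterS => k.
have /andP[u0 {}uq] := uq k; rewrite circ_dist0_01 ?u0 ?(le_lt_trans uq)//.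
rewrite gt_min ltrD2l ltrN2 (leNgt (u k)) in uq * => small.
by rewrite min_l//; move: small uq; lra.
Qed.

End CircleDistance.


Section CircleLift.
Variables (R : realType) (G g : R -> R).
Hypothesis dG : forall x : R, is_derive x 1 G (g x).
Hypothesis g_gt0 : forall x, 0 < g x.

Definition logder n x := \sum_(i < n) ln (g (iter i G x)).

Lemma logder0 x : logder 0 x = 0.
Proof. exact: big_ord0. Qed.

Lemma logderS n x : logder n.+1 x = logder n x + ln (g (iter n G x)).
Proof. exact: big_ord_recr. Qed.

Lemma logderSl n x : logder n.+1 x = ln (g x) + logder n (G x).
Proof.
rewrite /logder big_ord_recl; congr (_ + _).
by apply: eq_bigr => i _; rewrite -iterSr.
Qed.

Lemma logder1 x : logder 1 x = ln (g x).
Proof. exact: big_ord1. Qed.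

Lemma logderD n k x : logder (n + k) x = logder k x + logder n (iter k G x).
Proof.
by elim: n => [|n IH]; rewrite ?logder0 ?addr0// !logderS IH iterD addrA.
Qed.

Lemma is_derive_iter n (x : R) : is_derive x 1 (iter n G) (expR (logder n x)).
Proof.
elim: n => [|n IH] /=; first by rewrite logder0 expR0; exact: is_derive_id.
by rewrite logderS expRD lnK ?posrE// mulrC; apply: is_derive1_comp.
Qed.

Lemma continuous_iter n : continuous (iter n G).
Proof. exact: is_derive_continuous (is_derive_iter n). Qed.

Lemma lt_iter n : {mono iter n G : x y / x < y}.
Proof.
apply/leW_mono/le_mono => x y xy; rewrite -subr_gt0.
have [t _ ->] := MVT_barycentric x y (is_derive_iter n).
by rewrite mulr_gt0 ?expR_gt0 ?subr_gt0.
Qed.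

Lemma le_iter n : {mono iter n G : x y / x <= y}.
Proof. by apply: le_mono => x y; rewrite lt_iter. Qed.

Lemma iter_inj n : injective (iter n G).
Proof. exact: inc_inj (le_iter n). Qed.

Lemma iter_ivt n a b v : a <= b -> iter n G a <= v <= iter n G b ->
  exists2 c, a <= c <= b & iter n G c = v.
Proof.
move=> ab avb; have cGn := continuous_subspaceT (@continuous_iter n).
have [c] : exists2 c, c \in `[a, b] & iter n G c = v.
  by apply: IVT (cGn _) _; rewrite // min_l ?max_r ?le_iter.
by rewrite in_itv/=; exists c.
Qed.

Lemma orbit_nondecreasing x : x <= G x ->
  {homo (fun k => iter k G x) : m n / (m <= n)%N >-> m <= n}.
Proof.
by move=> xG; apply/nondecreasing_seqP => k; rewrite iterSr le_iter.
Qed.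

Lemma iter_dist n a b : {in `[a, b] &, forall x y, exists2 c, c \in `[a, b] &
  `|iter n G x - iter n G y| = expR (logder n c) * `|x - y|}.
Proof.
move=> x y xab yab; have [c cab ->] := MVT_norm (is_derive_iter n) xab yab.
by exists c; rewrite // ger0_norm ?expR_ge0.
Qed.

(* Cross-multiplied form of bounded distortion: ratios of lengths change by at
   most a factor [expR C]. *)
Lemma iter_length_ratio n a b C :
  {in `[a, b] &, forall x y, logder n x - logder n y <= C} ->
  forall x y z w, x \in `[a, b] -> y \in `[a, b] ->
    z \in `[a, b] -> w \in `[a, b] ->
  `|x - y| * `|iter n G z - iter n G w| <=
    expR C * `|z - w| * `|iter n G x - iter n G y|.
Proof.
move=> oscC x y z w xab yab zab wab.
have [c cab ->] := iter_dist n xab yab; have [e eab ->] := iter_dist n zab wab.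
rewrite mulrCA [leRHS]mulrACA [`|z - w| * _]mulrC.
rewrite ler_wpM2r ?mulr_ge0// -expRD ler_expR.
by rewrite -lerBlDr oscC.
Qed.

(* On [A], [iter n G] expands distances by at least [lam^-1], and its
   logarithmic derivative is [D]-Lipschitz in terms of the image point. *)
Definition expanding_on lam D n (A : interval R) := {in A &, forall x y,
  `|x - y| <= lam * `|iter n G x - iter n G y| /\
  logder n x - logder n y <= D * `|iter n G x - iter n G y|}.

Lemma expanding_onS lam D n A B : (A <= B)%O ->
  expanding_on lam D n B -> expanding_on lam D n A.
Proof.
by move=> AB expB x y xA yA; apply: expB; exact: subitvP AB _ _.
Qed.

Lemma expanding_on0 D A : 0 <= D -> expanding_on 1 D 0 A.
Proof. by move=> D0 x y _ _; rewrite !logder0 subrr mul1r mulr_ge0. Qed.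

Lemma expanding_on_comp lam C n A kap D j B : 0 <= lam -> 0 <= C ->
  {in A, forall x, iter n G x \in B} ->
  expanding_on lam C n A -> expanding_on kap D j B ->
  expanding_on (lam * kap) (C * kap + D) (j + n) A.
Proof.
move=> lam0 C0 AB expA expB x y xA yA; rewrite !iterD !logderD.
have [len dist] := expA _ _ xA yA.
have [lenB distB] := expB _ _ (AB _ xA) (AB _ yA); split.
  by rewrite (le_trans len)// -mulrA ler_wpM2l.
rewrite opprD addrACA mulrDl lerD// (le_trans dist)// -mulrA.
exact: ler_wpM2l.
Qed.

Lemma expanding_on_step lam L a b :
  {in `[a, b], forall x, 1 <= lam * g x} -> {in `[a, b], forall x, 1 <= g x} ->
  0 <= L ->
  {in `[a, b] &, forall x y, ln (g x) - ln (g y) <= L * `|x - y|} ->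
  expanding_on lam L 1 `[a, b].
Proof.
move=> lamg g1 L0 lipL x y xab yab; rewrite !logder1.
have [c cab ->] := iter_dist 1 xab yab.
rewrite logder1 lnK ?posrE//; split; first by rewrite mulrA ler_peMl ?lamg.
by rewrite (le_trans (lipL _ _ xab yab))// ler_wpM2l// ler_peMl ?g1.
Qed.

Lemma expanding_on_length_ratio lam D n a b s t : 0 <= D ->
  expanding_on lam D n `[a, b] -> a <= s -> s <= t -> t <= b ->
  (b - a) * (iter n G t - iter n G s) <=
    expR (D * (iter n G b - iter n G a)) * (t - s) *
      (iter n G b - iter n G a).
Proof.
move=> D0 expab as_ st tb; have ab := le_trans as_ (le_trans st tb).
have osc : {in `[a, b] &, forall x y,
    logder n x - logder n y <= D * (iter n G b - iter n G a)}.
  move=> x y xab yab; have [_] := expab _ _ xab yab; move/le_trans; apply.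
  have range z : z \in `[a, b] -> iter n G a <= iter n G z <= iter n G b.
    by rewrite !le_iter in_itv.
  rewrite ler_wpM2l// ler_norml.
  by have := range _ xab; have := range _ yab; lra.
have := iter_length_ratio osc (x := b) (y := a) (z := t) (w := s).
rewrite !in_itv/= !lexx ab as_ tb (le_trans st tb) (le_trans as_ st).
by rewrite !ger0_norm ?subr_ge0 ?le_iter//; apply.
Qed.

Variable d : int.
Hypothesis Gper : forall x, G (x + 1) = G x + d%:~R.

Lemma lift_int x (m : int) : G (x + m%:~R) = G x + (m * d)%:~R.
Proof.
have per : periodic (fun y => G y - d%:~R * y) 1.
  by move=> y; rewrite Gper; ring.
have := periodic_int per m x; rewrite intrM; lra.
Qed.

Lemma deriv_lift_int x (m : int) : g (x + m%:~R) = g x.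
Proof.
apply: periodic_int => {}x; have : is_derive x 1 (fun y => G (y + 1)) (g x).
  have -> : (fun y => G (y + 1)) = G + cst d%:~R by apply/funext.
  by rewrite -[g x]addr0; exact: is_deriveD.
have : is_derive x 1 (fun y => G (y + 1)) (g (x + 1)).
  by rewrite -[g _]mulr1 -[X in _ * X]addr0; exact: (@is_derive1_comp _ G).
by move=> /@derive_val <- /@derive_val <-.
Qed.

Lemma iter_int n x (m : int) :
  iter n G (x + m%:~R) = iter n G x + (m * d ^+ n)%:~R.
Proof.
elim: n => [|n IH]; first by rewrite mulr1.
by rewrite /= IH lift_int exprSr mulrA.
Qed.

Lemma logder_int n x (m : int) : logder n (x + m%:~R) = logder n x.
Proof. by apply: eq_bigr => i _; rewrite iter_int deriv_lift_int. Qed.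

Lemma expanding_on_int lam D n a b (m : int) : expanding_on lam D n `[a, b] ->
  expanding_on lam D n `[m%:~R + a, m%:~R + b].
Proof.
move=> expab x y; rewrite !in_itv/= => xab yab.
have shiftB (u v w : R) : (u + v) - (w + v) = u - w by ring.
have := expab (x - m%:~R) (y - m%:~R).
rewrite -mulrNz !(iter_int, logder_int) !shiftB mulrNz.
by apply; rewrite in_itv/= lerBrDl lerBlDl.
Qed.

Lemma basin0_iter n x : basin0 G (iter n G x) <-> basin0 G x.
Proof.
rewrite /basin0 /= -(cvg_shiftn n (fun k => circ_dist0 (iter k G x))).
by under [in X in _ <-> X]eq_fun do rewrite iterD.
Qed.

Lemma basin0_int x (m : int) : basin0 G (x + m%:~R) <-> basin0 G x.
Proof.
by rewrite /basin0 /=; under eq_fun do rewrite iter_int circ_dist0_int.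
Qed.

Lemma basin0_translate (m : int) : basin0 (fun x => G x + m%:~R) = basin0 G.
Proof.
have iterE k x : exists n : int,
    iter k (fun x => G x + m%:~R) x = iter k G x + n%:~R.
  elim: k => [|k [n IH]]; first by exists 0; rewrite addr0.
  by exists (n * d + m); rewrite /= IH lift_int intrD addrA.
apply/funext => x; rewrite /basin0/=.
rewrite (_ : (fun k => circ_dist0 (iter k (fun x => G x + m%:~R) x)) =
  (fun k => circ_dist0 (iter k G x)))//.
by apply/funext => k; have [n ->] := iterE k x; rewrite circ_dist0_int.
Qed.

Lemma fixed_not_basin0 x (m : int) : 0 < x < 1 -> G x = x + m%:~R ->
  ~ basin0 G x.
Proof.
move=> x01 Gx; rewrite -(basin0_translate (- m)) /basin0/=.
under eq_fun do rewrite iter_fix ?Gx ?mulrNz ?addrK// circ_dist0_01//.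
move/(cvg_unique (@norm_hausdorff _ _) (cvg_cst _)) => /eqP.
by rewrite gt_eqF// lt_min subr_gt0.
Qed.

Hypothesis G0 : G 0 = 0.

Section LeftOfZero.
Variable p : R.
Hypothesis G_gt : forall y, p < y < 0 -> y < G y.

Lemma left_orbit_cvg0 x : p < x <= 0 -> iter k G x @[k --> \oo] --> 0.
Proof.
move=> /andP[px x0]; have xG : x <= G x.
  move: x0; rewrite le_eqVlt => /orP[/eqP->|x0]; first by rewrite G0.
  by rewrite ltW// G_gt// px.
have u_inc := orbit_nondecreasing xG.
have u_le0 k : iter k G x <= 0 by rewrite -(iter_fix k G0) le_iter.
have u_cvg : cvgn (fun k => iter k G x).
  by apply: nondecreasing_is_cvgn => //; exists 0 => _ [k _ <-].
set l := limn _ in u_cvg.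
have xl : x <= l by exact: (nondecreasing_cvgn_le u_inc u_cvg 0).
have l0 : l <= 0 by apply: limr_le => //; exact: nearW.
have Gl : G l = l.
  apply: (continuous_cvg_fixed (continuous_iter (n:=1)) u_cvg).
  by rewrite -(cvg_shiftS (fun k => iter k G x)) in u_cvg.
suff <- : l = 0 by [].
apply/eqP; rewrite eq_le l0 leNgt; apply/negP => l_lt0.
by have := G_gt (y := l); rewrite l_lt0 (lt_le_trans px xl) Gl ltxx => /(_ isT).
Qed.

Lemma left_basin0 x : p < x <= 0 -> basin0 G x.
Proof. by move=> /left_orbit_cvg0/circ_dist0_cvg0. Qed.

End LeftOfZero.

Lemma last_fixed_point a b : a < 0 -> b < 0 -> G a <= a ->
  (forall y, b < y < 0 -> y < G y) ->
  exists p, [/\ a <= p < 0, G p = p & forall y, p < y < 0 -> y < G y].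
Proof.
move=> a0 b0 Ga G_gt.
have ab : a <= b.
  rewrite leNgt; apply/negP => ba.
  by have := G_gt a; rewrite ba a0 ltNge Ga => /(_ isT).
pose A := `[a, b]%classic `&` (fun x => G x - x) @^-1` [set y | y <= 0].
have A_a : A a by split; rewrite /= ?in_itv/= ?lexx// subr_le0.
have A_ub : has_ubound A by exists b => x [+ _]; rewrite /= in_itv => /andP[].
have A_closed : closed A.
  apply: closedI; first exact: itv_closed.
  apply: closed_comp (@closed_le R 0) => x _.
  by apply: cvgB; [exact: (is_derive_continuous dG)|exact: cvg_id].
have /A_closed[] : closure A (sup A) by apply: closure_sup => //; exists a.
set p := sup A; rewrite /= subr_le0 in_itv/= => /andP[ap pb] Gp.
have p0 : p < 0 by exact: le_lt_trans b0.
have above y : p < y < 0 -> y < G y.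
  move=> /andP[py y0].
  have [yb|b_lt_y] := leP y b; last by rewrite G_gt ?b_lt_y.
  rewrite ltNge; apply/negP => Gy.
  suff /(ub_le_sup A_ub) : A y by rewrite -/p leNgt py.
  by split; rewrite /= ?subr_le0// in_itv/= yb andbT (le_trans ap)// ltW.
exists p; split => //; first by rewrite ap.
have [|c /andP[pc c0] /= Gc] := iter_ivt (n := 1) (v := p) (ltW p0).
  by rewrite /= G0 Gp ltW.
move: pc; rewrite le_eqVlt => /orP[/eqP pc|pc]; first by rewrite [in LHS]pc.
have c_lt0 : c < 0.
  rewrite lt_neqAle c0 andbT; apply/eqP => c_eq0.
  by move: p0; rewrite -Gc c_eq0 G0 ltxx.
by have := above c; rewrite pc c_lt0 Gc ltNge (ltW pc) => /(_ isT).
Qed.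

Lemma right_orbit_not_cvg0 del x : 0 < del ->
  (forall y, 0 < y < del -> y < G y) -> (forall k, 0 < iter k G x) ->
  ~ (iter k G x @[k --> \oo] --> 0).
Proof.
move=> del0 G_gt u_gt0 u0.
have [N _ /(_ N (leqnn N))/= uN] := cvgr_lt 0 u0 _ del0.
have /orbit_nondecreasing v_inc : iter N G x <= G (iter N G x).
  by rewrite ltW// G_gt// u_gt0.
have v0 : (fun k => iter k G (iter N G x)) @ \oo --> 0.
  move: u0; rewrite -(cvg_shiftn N); under eq_fun do rewrite iterD.
  exact.
have v_cvg : cvgn (fun k => iter k G (iter N G x)) by apply/cvg_ex; exists 0.
have := nondecreasing_cvgn_le v_inc v_cvg 0.
by rewrite (cvg_lim (@Rhausdorff R) v0) leNgt u_gt0.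
Qed.

Lemma basin0_segment_iter x n : 0 <= x ->
  (forall z, 0 <= z <= x -> basin0 G z) ->
  forall z, 0 <= z <= iter n G x -> basin0 G z.
Proof.
move=> x0 seg z z0x.
have [|y yx <-] := iter_ivt (n := n) (v := z) x0.
  by rewrite (iter_fix n G0).
by apply/basin0_iter/seg.
Qed.

Lemma right_not_W0 q del (m : int) x : 0 < q < 1 -> G q = q + m%:~R ->
  0 < del -> (forall y, 0 < y < del -> y < G y) ->
  0 < x <= q -> ~ W0 G x.
Proof.
move=> q01 Gq del0 G_gt /andP[x0 xq] [n] /= seg.
have qB := fixed_not_basin0 q01 Gq; have /andP[q0 q1] := q01.
have [n_lt0|n_gt0|n0] := ltgtP n 0.
- have n1 : n%:~R <= -1 :> R by rewrite -[-1]/((-1)%:~R) ler_int -ltzD1 addNr.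
  apply: qB; apply/(basin0_int _ (-1)); apply: seg.
  by rewrite min_r ?max_l; lra.
- have n1 : 1 <= n%:~R :> R by rewrite ler1z -gtz0_ge1.
  by apply: qB; apply: seg; rewrite min_l ?max_r; lra.
have {n0}seg k : forall z, 0 <= z <= iter k G x -> basin0 G z.
  apply: basin0_segment_iter (ltW x0) _ => z z0x.
  by apply: seg; rewrite n0 addr0 min_l ?max_r ?(ltW x0).
have u_gt0 k : 0 < iter k G x by rewrite -(iter_fix k G0) lt_iter.
have u_le k : iter k G x <= q.
  by rewrite leNgt; apply/negP => /ltW qu; apply/qB/(seg k); rewrite (ltW q0).
apply: (right_orbit_not_cvg0 del0 G_gt u_gt0).
apply: (cvg0_circ_dist0 q1) => [k|]; first by rewrite u_gt0 u_le.
by apply: (seg 0%N); rewrite lexx (ltW x0).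
Qed.

Definition backward_orbit q (xs : nat -> R) :=
  [/\ xs 0%N = q, forall j, G (xs j.+1) = xs j, decreasing_seq xs &
    xs @ \oo --> (0 : R)].

Lemma preimages_cvg0 q (xs : nat -> R) : (forall y, 0 < y <= q -> y < G y) ->
  (forall j, 0 < xs j <= q) -> (forall j, G (xs j.+1) = xs j) ->
  xs @ \oo --> 0.
Proof.
move=> G_gt xs_in Gxs.
have xs_gt0 j : 0 < xs j by case/andP: (xs_in j).
have xs_dec : {homo xs : m n / (m <= n)%N >-> n <= m}.
  by apply/nonincreasing_seqP => j; rewrite -[leRHS]Gxs ltW// G_gt.
have xs_cvg : cvgn xs.
  by apply: nonincreasing_is_cvgn => //; exists 0 => _ [j _ <-]; exact: ltW.
set l := limn xs in xs_cvg.
have l0 : 0 <= l by apply: limr_ge => //; apply: nearW => j; exact: ltW.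
have lq : l <= q.
  have /andP[_] := xs_in 0%N; apply: le_trans.
  exact: (nonincreasing_cvgn_ge xs_dec xs_cvg).
have Gl : G l = l.
  rewrite -(cvg_shiftS xs) in xs_cvg.
  apply: (continuous_cvg_fixed (continuous_iter (n:=1)) xs_cvg).
  by under eq_fun do rewrite /= Gxs; rewrite (cvg_shiftS xs) in xs_cvg.
suff <- : l = 0 by [].
apply/eqP; rewrite eq_le l0 andbT leNgt; apply/negP => l_gt0.
by have := G_gt l; rewrite l_gt0 lq Gl ltxx => /(_ isT).
Qed.

Lemma backward_orbit_exists q : 0 < q -> (forall y, 0 < y <= q -> y < G y) ->
  exists xs, backward_orbit q xs.
Proof.
move=> q0 G_gt; have qG : q <= G q by rewrite ltW// G_gt// q0 lexx.
have /choice[xs xsP] j : exists x, 0 <= x <= q /\ iter j G x = q.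
  have [|x x0q Gx] := iter_ivt (n := j) (v := q) (ltW q0); last by exists x.
  by rewrite (iter_fix j G0) (ltW q0) (orbit_nondecreasing qG (leq0n j)).
have Gxs j : G (xs j.+1) = xs j.
  by apply: (iter_inj (n := j)); rewrite -iterSr !(xsP _).2.
have xs_in j : 0 < xs j <= q.
  have [/andP[x0 ->] Gx] := xsP j; rewrite andbT lt_neqAle x0 andbT.
  by apply/eqP => x_eq0; move: q0; rewrite -Gx -x_eq0 (iter_fix j G0) ltxx.
exists xs; split.
- exact: (xsP 0%N).2.
- exact: Gxs.
- by apply/decreasing_seqP => j; rewrite -[ltRHS]Gxs G_gt.
- exact: preimages_cvg0 G_gt xs_in Gxs.
Qed.

Section BackwardOrbit.
Variables (q : R) (xs : nat -> R).
Hypothesis xsP : backward_orbit q xs.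

Lemma backward_orbit_lt j : xs j.+1 < xs j.
Proof. by have [_ _ /decreasing_seqP xs_dec _] := xsP; exact: xs_dec. Qed.

Lemma backward_orbit_gt0 j : 0 < xs j.
Proof.
have [_ _ xs_dec xs0] := xsP; apply: le_lt_trans (backward_orbit_lt j).
rewrite -(cvg_lim (@Rhausdorff R) xs0).
apply: nonincreasing_cvgn_ge; last by apply/cvg_ex; exists 0.
by move=> m n; rewrite xs_dec.
Qed.

Lemma backward_orbit_le j : xs j <= q.
Proof. by have [<- _ xs_dec _] := xsP; rewrite xs_dec. Qed.

Lemma iter_backward_orbit n j : iter n G (xs (n + j)%N) = xs j.
Proof.
by have [_ Gxs _ _] := xsP; elim: n => // n IH; rewrite iterSr addSn Gxs.
Qed.

Lemma backward_orbit_itv y : 0 < y <= q -> exists j, xs j.+1 < y <= xs j.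
Proof.
have [xs0 _ _ xs_cvg] := xsP; move=> /andP[y0 yq].
have below : exists j, xs j < y.
  have [N _ /(_ N (leqnn N))/= xsN] := cvgr_lt 0 xs_cvg y y0.
  by exists N.
case: (ex_minnP below) => -[|j] xsj minj.
  by move: xsj; rewrite xs0 ltNge yq.
by exists j; rewrite xsj leNgt; apply/negP => /minj; rewrite ltnn.
Qed.

Section FundamentalDomains.
Variables L kap : R.
Hypothesis g_ge1 : {in `[0, q], forall x, 1 <= g x}.
Hypothesis L_ge0 : 0 <= L.
Hypothesis lng_lip :
  {in `[0, q] &, forall x y, ln (g x) - ln (g y) <= L * `|x - y|}.
Hypothesis kap_g : {in `[xs 1%N, q], forall x, 1 <= kap * g x}.

Let xs_lt := backward_orbit_lt.
Let xs_gt0 := backward_orbit_gt0.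
Let xs_le := backward_orbit_le.

Lemma fundamental_sub j : {subset `[xs j.+1, xs j] <= `[0, q]}.
Proof. by apply: subitvP; rewrite subitvE !bnd_simp ltW/=. Qed.

Lemma fundamental_step j u :
  u \in `[xs j.+2, xs j.+1] -> G u \in `[xs j.+1, xs j].
Proof.
have [_ Gxs _ _] := xsP.
have le_G : {mono G : x y / x <= y} := le_iter 1.
rewrite !in_itv/= => /andP[lo hi].
by rewrite -(Gxs j.+1) le_G lo -(Gxs j) le_G hi.
Qed.

Lemma fundamental_iter j u :
  u \in `[xs j.+1, xs j] -> iter j G u \in `[xs 1%N, q].
Proof.
have [xs0 _ _ _] := xsP; elim: j u => [|j IH] u; first by rewrite xs0.
by move=> /fundamental_step/IH; rewrite iterSr.
Qed.

Let expanding_step : expanding_on 1 L 1 `[0, q].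
Proof. by apply: expanding_on_step => // x /g_ge1; rewrite mul1r. Qed.

(* The images of a fundamental domain under the first [j] iterates are
   disjoint, so the sum of their lengths telescopes. *)
Lemma passage_logder_le j :
  {in `[xs j.+1, xs j] &, forall u v,
    logder j u - logder j v <= L * (xs 1%N - xs j.+1)}.
Proof.
elim: j => [|j IH] u v uj vj; first by rewrite !logder0 !subrr mulr0.
have := IH _ _ (fundamental_step uj) (fundamental_step vj).
have := lng_lip (fundamental_sub uj) (fundamental_sub vj).
have : L * `|u - v| <= L * (xs j.+1 - xs j.+2).
  apply: ler_wpM2l => //; rewrite ler_norml.
  by move: uj vj; rewrite !in_itv/=; lra.
rewrite !logderSl; lra.
Qed.

Definition passage_distortion := L * expR (L * q) / (q - xs 1%N).

Let q_gt_xs1 : 0 < q - xs 1%N.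
Proof. by have [<- _ _ _] := xsP; rewrite subr_gt0. Qed.

Lemma passage_distortion_ge0 : 0 <= passage_distortion.
Proof. by rewrite divr_ge0 ?mulr_ge0 ?expR_ge0 ?(ltW q_gt_xs1). Qed.

Lemma passage_length_le j :
  {in `[xs j.+1, xs j] &, forall u v, L * `|u - v| <=
    passage_distortion * (xs j - xs j.+1) * `|iter j G u - iter j G v|}.
Proof.
have [xs0 _ _ _] := xsP.
have oscj : {in `[xs j.+1, xs j] &, forall u v,
    logder j u - logder j v <= L * q}.
  move=> u v uj vj; apply: le_trans (passage_logder_le uj vj) _.
  by rewrite ler_wpM2l//; have := xs_gt0 j.+1; have := xs_le 1; lra.
move=> u v uj vj; have xs_j : 0 < xs j - xs j.+1 by rewrite subr_gt0.
have topj : xs j \in `[xs j.+1, xs j] by rewrite in_itv/= lexx ltW.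
have botj : xs j.+1 \in `[xs j.+1, xs j] by rewrite in_itv/= lexx ltW.
have := iter_length_ratio oscj uj vj topj botj.
have itj i : iter j G (xs (j + i)) = xs i := iter_backward_orbit j i.
have := itj 0%N; have := itj 1%N; rewrite addn0 addn1 xs0 => -> ->.
rewrite (gtr0_norm xs_j) (gtr0_norm q_gt_xs1) -ler_pdivlMr// => len.
rewrite [leRHS](_ : _ = L * (expR (L * q) * (xs j - xs j.+1) *
  `|iter j G u - iter j G v| / (q - xs 1%N))); first exact: ler_wpM2l.
by rewrite /passage_distortion; ring.
Qed.

Lemma passage_expanding j : expanding_on 1
  (passage_distortion * (xs 1%N - xs j.+1)) j `[xs j.+1, xs j].
Proof.
elim: j => [|j IH] u v uj vj.
  by rewrite !logder0 !subrr mul1r mulr0 mul0r.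
have u0q := fundamental_sub uj; have v0q := fundamental_sub vj.
have [len dist] := IH _ _ (fundamental_step uj) (fundamental_step vj).
rewrite !logderSl !iterSr; split.
  have [+ _] := expanding_step u0q v0q; rewrite !mul1r in len *.
  by move/le_trans; apply.
have := lng_lip u0q v0q; have := passage_length_le uj vj; rewrite !iterSr.
move: dist; lra.
Qed.

Lemma return_expanding j : expanding_on kap
  (passage_distortion * q * kap + L) j.+1 `[xs j.+1, xs j].
Proof.
have [xs0 _ _ _] := xsP.
have kap0 : 0 <= kap.
  have xs1 : xs 1%N \in `[xs 1%N, q] by rewrite in_itv/= lexx xs_le.
  by rewrite -(pmulr_lge0 kap (g_gt0 (xs 1%N))) (le_trans ler01 (kap_g xs1)).
rewrite -[kap in X in expanding_on X]mul1r.
apply: (@expanding_on_comp 1 _ j _ kap L 1 `[xs 1%N, q]) => //.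
- rewrite mulr_ge0 ?passage_distortion_ge0//.
  exact: le_trans (ltW (xs_gt0 0)) (xs_le 0).
- exact: fundamental_iter.
- move=> u v uj vj; have [len dist] := passage_expanding uj vj; split => //.
  apply: le_trans dist _; apply: ler_wpM2r => //.
  apply: ler_wpM2l; first exact: passage_distortion_ge0.
  by have := xs_gt0 j.+1; have := xs_le 1; lra.
have sub1 : (`[xs 1%N, q] <= `[0, q])%O by rewrite subitvE !bnd_simp ltW/=.
apply: expanding_on_step => //; first by move=> x /(subitvP sub1)/g_ge1.
by move=> x y /(subitvP sub1) x0 /(subitvP sub1); exact: lng_lip.
Qed.

End FundamentalDomains.
End BackwardOrbit.

Section Survivors.
Variable q : R.

Definition gaps : set R :=
  \bigcup_(m in [set: int]) `]m%:~R + q, m%:~R + 1[%classic.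

Lemma in_gaps x (m : int) : m%:~R + q < x < m%:~R + 1 -> gaps x.
Proof. by move=> xm; exists m => //=; rewrite in_itv. Qed.

Lemma not_gapsP x : ~ gaps x -> exists m : int, m%:~R <= x <= m%:~R + q.
Proof.
move=> gapx; exists (Num.floor x); rewrite floor_le leNgt; apply/negP => xq.
apply/gapx/(@in_gaps _ (Num.floor x)); rewrite xq.
by have /andP[_] := floor_itv x; rewrite intrD.
Qed.

Definition survivors : set R := \bigcap_n (iter n G @^-1` (~` gaps)).

Lemma measurable_survivors : measurable survivors.
Proof.
apply: closed_measurable; apply: closed_bigI => n _; apply: closed_comp.
  by move=> x _; exact: continuous_iter.
by rewrite closedC; apply: bigcup_open => m _; exact: itv_open.
Qed.

Hypothesis q_gt0 : 0 < q.
Hypothesis q_lt1 : q < 1.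
Hypothesis d_gt1 : 1 < d.
Hypothesis Gq : G q = q + (d - 1)%:~R.

Definition full_branch lam D n (m : int) a b :=
  [/\ iter n G a = m%:~R, iter n G b = m%:~R + q &
    expanding_on lam D n `[a, b]].

Lemma full_branch0 D m : 0 <= D -> full_branch 1 D 0 m m%:~R (m%:~R + q).
Proof. by move=> D0; split; last exact: expanding_on0. Qed.

Lemma full_branch_lt lam D n m a b : full_branch lam D n m a b -> a < b.
Proof. by move=> [Ga Gb _]; rewrite -(lt_iter n) Ga Gb ltrDl. Qed.

Lemma full_branch_length lam D n m a b :
  full_branch lam D n m a b -> b - a <= lam * q.
Proof.
move=> br; have /ltW ab := full_branch_lt br; case: br => Ga Gb.
have bab : b \in `[a, b] by rewrite in_itv/= lexx ab.
have aab : a \in `[a, b] by rewrite in_itv/= lexx ab.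
case/(_ b a bab aab) => + _; rewrite Ga Gb addrAC subrr add0r.
by rewrite ger0_norm ?subr_ge0// gtr0_norm.
Qed.

Lemma full_branch_comp lam C n m a b kap D j l s t : 0 <= lam -> 0 <= C ->
  full_branch lam C n m a b -> full_branch kap D j l s t ->
  0 <= s -> t <= q ->
  exists a' b', [/\ iter n G a' = m%:~R + s, iter n G b' = m%:~R + t &
    full_branch (lam * kap) (C * kap + D) (j + n) (l + m * d ^+ j) a' b'].
Proof.
move=> lam0 C0 brab brst s0 tq.
have /ltW ab := full_branch_lt brab; have /ltW st := full_branch_lt brst.
case: brab brst => [Ga Gb expab] [Gs Gt expst].
have onto v : 0 <= v <= q -> exists2 c, a <= c <= b & iter n G c = m%:~R + v.
  by move=> vq; apply: iter_ivt => //; rewrite Ga Gb; lra.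
have [|a' /andP[aa' _] Ga'] := onto s; first by rewrite s0 (le_trans st).
have [|b' /andP[_ bb'] Gb'] := onto t; first by rewrite tq (le_trans s0).
exists a', b'; split => //; split.
- by rewrite iterD Ga' addrC iter_int Gs intrD.
- by rewrite iterD Gb' addrC iter_int Gt intrD addrAC.
have expst_m : expanding_on kap D j `[m%:~R + s, m%:~R + t].
  exact: expanding_on_int expst.
apply: (expanding_on_comp lam0 C0 _ _ expst_m).
  by move=> x; rewrite !in_itv/= -Ga' -Gb' !le_iter.
by apply: expanding_onS expab; rewrite subitvE !bnd_simp aa'.
Qed.

Lemma integral_orbit_porous x n (m : int) : iter n G x = m%:~R ->
  porous_at survivors x.
Proof.
move=> Gx; exists 1 => // e e0.
have gapm : m%:~R - 1 + q < iter n G x by rewrite Gx; move: q_lt1; lra.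
have /nbhs_ballP[r /= r0 near_gap] :
    \forall z \near x, m%:~R - 1 + q < iter n G z.
  exact: (cvgr_gt _ (@continuous_iter n x)).
pose r' := Num.min (e / 2) r.
have r'_gt0 : 0 < r' by rewrite lt_min r0 divr_gt0.
exists r', (x - r'), x; split => //.
- by rewrite r'_gt0 gt_min; apply/orP; left; move: e0; lra.
- by rewrite lerDl ltW.
- by rewrite mul1r opprB addrC subrK.
move=> z; rewrite /= in_itv/= => /andP[rz zx] /(_ n I); apply.
apply: (@in_gaps _ (m - 1)); rewrite intrD near_gap/=.
  by rewrite subrK -Gx lt_iter.
have : r' <= r by rewrite ge_min lexx orbT.
by rewrite -ball_normE/= ltr_distl; move: rz zx r'_gt0; lra.
Qed.

Definition nonintegral_survivor x :=
  forall n, exists m : int, m%:~R < iter n G x <= m%:~R + q.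

Lemma nonintegral_survivor_iter x n (m : int) :
  nonintegral_survivor x -> nonintegral_survivor (iter n G x - m%:~R).
Proof.
move=> xint i; have [l xl] := xint (i + n)%N; exists (l - m * d ^+ i).
by move: xl; rewrite iterD -mulrNz iter_int mulNr intrD; lra.
Qed.

Section Returns.
Variables (L kap D : R) (xs : nat -> R).
Hypothesis L_ge0 : 0 <= L.
Hypothesis expanding_step : expanding_on 1 L 1 `[0, q].
Hypothesis xsP : backward_orbit q xs.
Hypothesis kap_ge0 : 0 <= kap.
Hypothesis kap_lt1 : kap < 1.
Hypothesis D_ge0 : 0 <= D.
Hypothesis expanding_return :
  forall j, expanding_on kap D j.+1 `[xs j.+1, xs j].

Lemma return_branch y : 0 < y <= q -> nonintegral_survivor y ->
  exists j l s t, [/\ 0 <= s, t <= q, s < y <= t & full_branch kap D j l s t].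
Proof.
move=> yq yint; have [j /andP[xjy yxj]] := backward_orbit_itv xsP yq.
have itxs i : iter i G (xs i) = q.
  have [xs0 _ _ _] := xsP.
  by have := iter_backward_orbit xsP i 0; rewrite addn0 xs0.
have [l /andP[ly ylq]] := yint j.+1.
have itjy : q < iter j.+1 G y by rewrite -(itxs j.+1) lt_iter.
have ityj : iter j.+1 G y <= q + (d - 1)%:~R by rewrite -Gq -(itxs j) le_iter.
have l1 : 1 <= l%:~R :> R.
  have : 0 < l%:~R :> R by move: itjy; lra.
  by rewrite ltr0z ler1z -gtz0_ge1.
have ld : l%:~R <= (d - 1)%:~R :> R.
  rewrite ler_int -ltzD1 subrK -(ltr_int R).
  by move: ly ityj q_lt1; rewrite intrD; lra.
have [s /andP[xjs sy] its] :
    exists2 s, xs j.+1 <= s <= y & iter j.+1 G s = l%:~R.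
  by apply: iter_ivt (ltW xjy) _ => //; rewrite itxs; move: l1 ly q_lt1; lra.
have [t /andP[yt txj] itt] :
    exists2 t, y <= t <= xs j & iter j.+1 G t = l%:~R + q.
  apply: iter_ivt yxj _ => //; rewrite ylq iterS itxs Gq; lra.
exists j.+1, l, s, t; split.
- exact: le_trans (ltW (backward_orbit_gt0 xsP _)) xjs.
- exact: le_trans txj (backward_orbit_le xsP _).
- by rewrite -(lt_iter j.+1) its ly.
split=> //; apply: expanding_onS (@expanding_return j).
by rewrite subitvE !bnd_simp xjs.
Qed.

(* The fixed point of [C |-> C * kap + D]. *)
Definition branch_distortion := D / (1 - kap).

Lemma branch_distortion_ge0 : 0 <= branch_distortion.
Proof. by rewrite divr_ge0// subr_ge0 ltW. Qed.

Lemma nonintegral_survivor_full_branch x k : nonintegral_survivor x ->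
  exists n m a b, a < x <= b /\
    full_branch (kap ^+ k) branch_distortion n m a b.
Proof.
move=> xint; elim: k => [|k [n [m [a [b [/andP[ax xb] br]]]]]].
  have [m xm] := xint 0%N; exists 0%N, m, m%:~R, (m%:~R + q); split => //.
  exact: full_branch0 branch_distortion_ge0.
have yq : 0 < iter n G x - m%:~R <= q.
  case: br => Ga Gb _; rewrite subr_gt0 lerBlDl -Gb -Ga.
  by rewrite lt_iter ax le_iter.
have [j [l [s [t [s0 tq /andP[sy yt] brst]]]]] :=
  return_branch yq (nonintegral_survivor_iter n m xint).
have [a' [b' [Ga' Gb' br']]] := full_branch_comp
  (exprn_ge0 k kap_ge0) branch_distortion_ge0 br brst s0 tq.
exists (j + n)%N, (l + m * d ^+ j), a', b'; split.
  by rewrite -(lt_iter n) -(le_iter n) Ga' Gb' -ltrBrDl -lerBlDl sy.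
rewrite exprSr (_ : branch_distortion = branch_distortion * kap + D)//.
by rewrite /branch_distortion; field; rewrite subr_eq0 gt_eqF.
Qed.

Lemma full_branch_step lam n m a b : 0 <= lam ->
  full_branch lam branch_distortion n m a b ->
  [/\ iter n.+1 G a = (m * d)%:~R, iter n.+1 G b = (m * d)%:~R + G q &
    expanding_on lam (branch_distortion + L) n.+1 `[a, b]].
Proof.
move=> lam0 [Ga Gb expab]; split.
- by rewrite iterS Ga -[m%:~R]add0r lift_int G0 add0r.
- by rewrite iterS Gb addrC lift_int addrC.
have step_m : expanding_on 1 L 1 `[m%:~R + 0, m%:~R + q].
  exact: expanding_on_int expanding_step.
rewrite -[lam]mulr1 -[branch_distortion]mulr1.
apply: (expanding_on_comp lam0 branch_distortion_ge0 _ expab step_m) => x.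
by rewrite !in_itv/= addr0 -Gb -Ga !le_iter.
Qed.

Let Gq_gt1 : 1 < G q.
Proof.
have d1 : 1 <= (d - 1)%:~R :> R by rewrite ler1z -gtz0_ge1 subr_gt0.
by rewrite Gq (le_lt_trans d1)// ltrDr.
Qed.

Definition gap_ratio :=
  (1 - q) / (expR ((branch_distortion + L) * G q) * G q).

Lemma gap_ratio_gt0 : 0 < gap_ratio.
Proof.
have Gq0 : 0 < G q by exact: lt_trans Gq_gt1.
by rewrite divr_gt0 ?subr_gt0// mulr_gt0 ?expR_gt0.
Qed.

Lemma full_branch_gap lam n m a b : 0 <= lam ->
  full_branch lam branch_distortion n m a b ->
  exists s t, [/\ a <= s, t <= b, gap_ratio * (b - a) <= t - s &
    `]s, t[ `<=` ~` survivors].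
Proof.
move=> lam0 br; have /ltW ab := full_branch_lt br.
have [Ga Gb expab] := full_branch_step lam0 br.
have onto v : 0 <= v <= G q ->
    exists2 c, a <= c <= b & iter n.+1 G c = (m * d)%:~R + v.
  by move=> vq; apply: iter_ivt => //; rewrite Ga Gb; lra.
have [|s /andP[as_ _] Gs] := onto q; first by move: q_gt0 q_lt1 Gq_gt1; lra.
have [|t /andP[_ tb] Gt] := onto 1; first by move: Gq_gt1; lra.
have st : s < t by rewrite -(lt_iter n.+1) Gs Gt ltrD2l.
exists s, t; split => //.
  have distortion_ge0 : 0 <= branch_distortion + L.
    by rewrite addr_ge0 ?branch_distortion_ge0.
  have := expanding_on_length_ratio distortion_ge0 expab as_ (ltW st) tb.
  rewrite Gs Gt Ga Gb opprD addrACA subrr add0r addrAC subrr add0r => ratio.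
  have Gq0 : 0 < G q by exact: lt_trans Gq_gt1.
  rewrite /gap_ratio mulrAC ler_pdivrMr ?mulr_gt0 ?expR_gt0//.
  by rewrite mulrC mulrA [(t - s) * _]mulrC.
move=> z; rewrite /= in_itv/= => /andP[sz zt] /(_ n.+1 I); apply.
by apply: (@in_gaps _ (m * d)); rewrite -Gs -Gt !lt_iter sz.
Qed.

Lemma nonintegral_survivor_porous x :
  nonintegral_survivor x -> porous_at survivors x.
Proof.
move=> xint; exists gap_ratio => [|e e0]; first exact: gap_ratio_gt0.
have [k _ /(_ k (leqnn k))/= kap_small] :
    \forall k \near \oo, kap ^+ k < e / q.
  by apply: cvgr_lt; [apply: cvg_expr; rewrite ger0_norm|rewrite divr_gt0].
have [n [m [a [b [/andP[ax xb] br]]]]] :=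
  nonintegral_survivor_full_branch k xint.
have [s [t [as_ tb ratio gap]]] := full_branch_gap (exprn_ge0 k kap_ge0) br.
have ab := full_branch_lt br; exists (b - a), s, t; split => //.
- rewrite subr_gt0 ab (le_lt_trans (full_branch_length br))//.
  by rewrite -ltr_pdivlMr.
- by apply: le_trans as_; rewrite lerBlDr; move: ab xb; lra.
- by apply: le_trans tb _; move: ax; lra.
Qed.

Lemma survivors_porous x : survivors x -> porous_at survivors x.
Proof.
move=> xS.
have [[n [m Gx]]|not_int] := pselect (exists n (m : int), iter n G x = m%:~R).
  exact: integral_orbit_porous Gx.
apply: nonintegral_survivor_porous => n.
have [m /andP[mx xm]] := not_gapsP (xS n I).
exists m; rewrite xm andbT lt_neqAle mx andbT; apply/eqP => mGx.
by apply: not_int; exists n, m.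
Qed.

Lemma survivors_measure0 : lebesgue_measure survivors = 0%E.
Proof. exact: porous_measure0 measurable_survivors survivors_porous. Qed.

End Returns.
End Survivors.

Lemma gap_basin0 q x :
  (forall y, q - 1 < y < 0 -> y < G y) -> q < x <= 1 -> basin0 G x.
Proof.
move=> G_gt xq; apply/(basin0_int _ (-1)).
by apply: (left_basin0 G_gt); lra.
Qed.

Lemma not_basin0_survivors q : (forall y, q - 1 < y < 0 -> y < G y) ->
  ~` basin0 G `<=` survivors q.
Proof.
move=> G_gt x xB n _ [m _]; rewrite /= in_itv/= => /andP[mx xm]; apply: xB.
apply/(basin0_iter n)/(basin0_int _ (- m))/(gap_basin0 G_gt).
by rewrite mulrNz; move: mx xm; lra.
Qed.

Section SaddleNode.
Variable g2 : R -> R.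
Hypothesis dg : forall x : R, is_derive x 1 g (g2 x).
Hypothesis cg2 : continuous g2.
Hypothesis g01 : g 0 = 1.

(* Two applications of the mean value theorem write [G y - y] as
   [g2 (s * (t * y)) * t * y ^+ 2] with [0 < s, t < 1]. *)
Lemma saddle_node_gt_id : 0 < g2 0 ->
  exists2 del, 0 < del & forall y, y != 0 -> `|y| < del -> y < G y.
Proof.
move=> g20.
have /nbhs_ballP[del /= del0 g2_gt0] : \forall x \near (0 : R), 0 < g2 x.
  exact: (cvgr_gt _ (@cg2 0)).
exists del => // y y0 ydel.
have [t /andP[t0 t1]] := MVT_barycentric 0 y dG.
rewrite G0 !subr0 add0r => ->.
have [s /andP[s0 s1]] := MVT_barycentric 0 (t * y) dg.
rewrite g01 subr0 add0r => /eqP; rewrite subr_eq => /eqP ->.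
have g2_pos : 0 < g2 (s * (t * y)).
  apply: (g2_gt0 (s * (t * y))); rewrite -ball_normE/= sub0r normrN mulrA.
  rewrite normrM ger0_norm ?mulr_ge0 ?ltW//; apply: le_lt_trans ydel.
  by rewrite ler_piMl// mulr_ile1 ?ltW.
rewrite mulrDl mul1r ltrDr -mulrA -[t * y * y]mulrA -expr2.
by rewrite mulr_gt0// mulr_gt0// exprn_even_gt0.
Qed.

Section ExpandingInterval.
Variable q : R.
Hypothesis q_gt0 : 0 < q.
Hypothesis g_gt1 : forall x, 0 < x <= q -> 1 < g x.

Lemma deriv_ge1 : {in `[0, q], forall x, 1 <= g x}.
Proof.
move=> x; rewrite in_itv/= le_eqVlt => /andP[/orP[/eqP <-|x0] xq].
  by rewrite g01.
by rewrite ltW// g_gt1// x0.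
Qed.

Lemma ln_deriv_lipschitz : exists2 L, 0 <= L &
  {in `[0, q] &, forall x y, ln (g x) - ln (g y) <= L * `|x - y|}.
Proof.
have cabs : {within `[0, q], continuous (fun x => `|g2 x|)}.
  by apply: continuous_subspaceT => x; apply: cvg_norm; exact: cg2.
have [c _ cmax] := EVT_max (ltW q_gt0) cabs; exists `|g2 c| => // x y x0q y0q.
have dln (z : R) : is_derive z 1 (@ln R \o g) ((g z)^-1 * g2 z).
  by apply: is_derive1_comp; exact: is_derive1_ln.
apply: le_trans (ler_norm _) _.
have [z z0q /= ->] := MVT_norm dln x0q y0q.
rewrite ler_wpM2r// normrM ger0_norm ?invr_ge0 ?(ltW (g_gt0 _))//.
by apply: le_trans (cmax _ z0q); rewrite ler_piMl// invf_le1// deriv_ge1.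
Qed.

Lemma lift_gt_id y : 0 < y <= q -> y < G y.
Proof.
move=> /andP[y0 yq]; have [t /andP[t0 t1]] := MVT_barycentric 0 y dG.
rewrite G0 !subr0 add0r => ->; rewrite ltr_pMl// g_gt1// mulr_gt0//=.
by apply: le_trans yq; rewrite ler_piMl// ltW.
Qed.

Lemma expanding_survivors_measure0 :
  q < 1 -> 1 < d -> G q = q + (d - 1)%:~R ->
  lebesgue_measure (survivors q) = 0%E.
Proof.
move=> q_lt1 d_gt1 Gq.
have [xs xsP] := backward_orbit_exists q_gt0 lift_gt_id.
have [L L0 lipL] := ln_deriv_lipschitz.
have xs1_gt0 := backward_orbit_gt0 xsP 1.
have xs1q := backward_orbit_le xsP 1.
have cg := continuous_subspaceT (is_derive_continuous dg).
have [c c1q cmin] := EVT_min xs1q (cg _).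
have gc1 : 1 < g c.
  by rewrite g_gt1 ?(itvP c1q)// (lt_le_trans xs1_gt0) ?(itvP c1q).
have kap_g : {in `[xs 1%N, q], forall x, 1 <= (g c)^-1 * g x}.
  by move=> x x1q; rewrite mulrC ler_pdivlMr// mul1r cmin.
apply: (survivors_measure0 q_gt0 q_lt1 d_gt1 Gq L0 _ xsP _ _ _
  (return_expanding xsP deriv_ge1 L0 lipL kap_g)).
- by apply: expanding_on_step => // x x0q; rewrite ?mul1r deriv_ge1.
- by rewrite invr_ge0 ltW.
- by rewrite invf_lt1.
apply: (addr_ge0 _ L0); apply: mulr_ge0; last by rewrite invr_ge0 ltW.
by apply: (mulr_ge0 _ (ltW q_gt0)); exact: (passage_distortion_ge0 xsP L0).
Qed.

End ExpandingInterval.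

Lemma not_basin0_measure0 : 0 < g2 0 ->
  (forall x, ~ W0 G x -> 1 < g x) -> lebesgue_measure (~` basin0 G) = 0%E.
Proof.
move=> g20 expand.
have [del del0 push] := saddle_node_gt_id g20.
have [no_fixed|] := pselect (forall y, -1 < y < 0 -> y < G y).
  rewrite (_ : ~` _ = set0) ?measure0//; apply/seteqP; split => // x /= xB.
  apply: xB; apply/(basin0_int _ (1 - Num.ceil x)).
  apply: (@gap_basin0 0); rewrite ?sub0r//.
  by have := ceil_itv x; rewrite intrD mulrNz; lra.
move=> /existsNP[a /not_implyP[/andP[a1 a0] /negP]]; rewrite -leNgt => Ga.
have [|y /andP[dy y0]|p [/andP[ap p0] Gp G_gt]] :=
  @last_fixed_point a (- del) a0 _ Ga.
- by rewrite oppr_lt0.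
- by apply: push; rewrite ?lt_eqF// ltr0_norm//; lra.
pose q := p + 1; have q01 : 0 < q < 1 by rewrite /q; lra.
have /andP[q0 q1] := q01.
have Gq : G q = q + (d - 1)%:~R by rewrite /q Gper Gp intrD; lra.
have g_gt1 x : 0 < x <= q -> 1 < g x.
  move=> xq; apply: expand.
  apply: (right_not_W0 q01 Gq del0 _ xq) => y /andP[y0 yd].
  by apply: push; rewrite ?gt_eqF// gtr0_norm.
have d_gt1 : 1 < d.
  have /(lift_gt_id g_gt1) : 0 < q <= q by rewrite q0 lexx.
  by rewrite Gq ltrDl ltr0z subr_gt0.
apply: subset_lebesgue_measure0
  (expanding_survivors_measure0 q0 g_gt1 q1 d_gt1 Gq).
by apply: not_basin0_survivors; rewrite /q addrK.
Qed.

End SaddleNode.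
End CircleLift.

Theorem theorem2p1 (R : realType) (F : R -> R) :
  circle_lift F ->
  C2 F ->
  (forall x, derive1 F x != 0) ->
  (* 0 is a saddle-node fixed point *)
  is_int (F 0) -> derive1 F 0 = 1 -> 0 < derive1n 2 F 0 ->
  (* it is the unique saddle-node fixed point on M *)
  (forall x, is_int (F x - x) -> derive1 F x = 1 -> 0 < derive1n 2 F x -> is_int x) ->
  (* expansion outside W_0 *)
  (forall x, ~ W0 F x -> 1 < `|derive1 F x|) ->
  lebesgue_measure ([set x : R | 0 <= x < 1] `\` basin0 F) = 0%E.
Proof.
move=> [d Fper] [/derivable_is_derive1 dF [/derivable_is_derive1 ddF cF2]].
move=> F'_neq0 [n F0] F'0 F''0 _ expand.
have F'_gt0 : forall x, 0 < derive1 F x.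
  apply: (neq0_continuous_gt0 (a := 0) (is_derive_continuous ddF)) => //.
  by rewrite F'0.
pose G x := F x - n%:~R.
have Gper x : G (x + 1) = G x + d%:~R by rewrite /G Fper addrAC.
have dG (x : R) : is_derive x 1 G (derive1 F x).
  by rewrite -[derive1 F x]subr0; exact: is_deriveB.
have basinFG : basin0 F = basin0 G.
  rewrite -(basin0_translate Gper n); congr basin0.
  by apply/funext => x; rewrite /G subrK.
have expandG x : ~ W0 G x -> 1 < derive1 F x.
  rewrite -[derive1 F x]gtr0_norm// => xW.
  by apply: expand; rewrite /W0 basinFG.
have G0 : G 0 = 0 by rewrite /G F0 subrr.
rewrite basinFG; apply: subset_lebesgue_measure0
  (not_basin0_measure0 dG F'_gt0 Gper G0 ddF cF2 F'0 F''0 expandG).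
by move=> x [].
Qed.
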